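(* Let $\mathcal{H}$ be a right quaternionic Hilbert space and let $T\in\mathcal{B}(\mathcal{H})$ be a bounded right $\mathbb{H}$-linear operator. Then the right spectrum of $T$ equals its $S$-spectrum: $$\sigma(T)=\sigma_S(T).$$
   Context: $\mathbb{H}$ denotes the division ring of real quaternions. For $q=a_0+a_1i+a_2j+a_3k\in\mathbb{H}$, $\mathrm{Re}(q)=a_0$, $\mathrm{Im}(q)=a_1i+a_2j+a_3k$, $q^*=\mathrm{Re}(q)-\mathrm{Im}(q)$, and $|q|=\sqrt{qq^*}$. A right quaternionic Hilbert space $\mathcal{H}$ is a right $\mathbb{H}$-module with an ($\mathbb{H}$-valued) inner product $\langle\cdot,\cdot\rangle$ (conjugate-symmetric, positive definite, right $\mathbb{H}$-linear in one argument in the usual sense), complete with respect to the norm $\|x\|=\sqrt{\langle x,x\rangle}$. A map $T:\mathcal{H}\to\mathcal{H}$ is right $\mathbb{H}$-linear if $T(u\alpha+v\beta)=T(u)\alpha+T(v)\beta$ for all $u,v\in\mathcal{H}$, $\alpha,\beta\in\mathbb{H}$, and $\mathbb{R}$-linear if this holds for all $\alpha,\beta\in\mathbb{R}$; it is bounded if there is $K\ge 0$ with $\|Tx\|\le K\|x\|$ for all $x\in\mathcal{H}$. $\mathcal{B}(\mathcal{H})$ is the set of bounded right $\mathbb{H}$-linear operators on $\mathcal{H}$ and $\mathcal{B}_{\mathbb{R}}(\mathcal{H})\supseteq\mathcal{B}(\mathcal{H})$ is the set of bounded $\mathbb{R}$-linear operators on $\mathcal{H}$. An operator is invertible in one of these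 sets if it has a two-sided inverse belonging to that set. For $T\in\mathcal{B}(\mathcal{H})$ and $\lambda\in\mathbb{H}$: - $T_\lambda\in\mathcal{B}_{\mathbb{R}}(\mathcal{H})$ is the operator $T_\lambda(x)=x\lambda-Tx$ (in general not right $\mathbb{H}$-linear). - $\Delta_\lambda(T)=T^2-2\,\mathrm{Re}(\lambda)T+|\lambda|^2I\in\mathcal{B}(\mathcal{H})$. The right spectrum is $\sigma(T)=\{\lambda\in\mathbb{H}: T_\lambda\text{ is not invertible in }\mathcal{B}_{\mathbb{R}}(\mathcal{H})\}$. The $S$-spectrum is $\sigma_S(T)=\{\lambda\in\mathbb{H}: \Delta_\lambda(T)\text{ is not invertible in }\mathcal{B}(\mathcal{H})\}$. *)

(* Defs.v *)
From HB Require Import structures.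
From mathcomp Require Import all_boot all_order all_algebra.
From mathcomp Require Import all_classical all_reals all_analysis.
From mathcomp Require Import ring.

Set Implicit Arguments.
Unset Strict Implicit.
Unset Printing Implicit Defensive.

Import Order.TTheory GRing.Theory Num.Theory.
Import numFieldNormedType.Exports.

Local Open Scope classical_set_scope.
Local Open Scope ring_scope.

(* [Quat a b c d] is a + b i + c j + d k. *)
Record quat (R : Type) := Quat { qre : R; qi : R; qj : R; qk : R }.

Section QuatRing.
Variable R : realType.
Implicit Types p q r : quat R.

Definition tuple_of_quat q := (qre q, qi q, qj q, qk q).
Definition quat_of_tuple (t : R * R * R * R) :=
  let: (a, b, c, d) := t in Quat a b c d.

Lemma tuple_of_quatK : cancel tuple_of_quat quat_of_tuple.
Proof. by case. Qed.

HB.instance Definition _ := Choice.copy (quat R) (can_type tuple_of_quatK).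

Definition addq p q :=
  Quat (qre p + qre q) (qi p + qi q) (qj p + qj q) (qk p + qk q).
Definition oppq q := Quat (- qre q) (- qi q) (- qj q) (- qk q).

(* i^2 = j^2 = k^2 = i j k = -1 *)
Definition mulq p q :=
  Quat (qre p * qre q - qi p * qi q - qj p * qj q - qk p * qk q)
       (qre p * qi q + qi p * qre q + qj p * qk q - qk p * qj q)
       (qre p * qj q - qi p * qk q + qj p * qre q + qk p * qi q)
       (qre p * qk q + qi p * qj q - qj p * qi q + qk p * qre q).

Definition realq (a : R) : quat R := Quat a 0 0 0.

Lemma quat_eq p q : qre p = qre q -> qi p = qi q -> qj p = qj q ->
  qk p = qk q -> p = q.
Proof. by case: p => ? ? ? ?; case: q => ? ? ? ? /= -> -> -> ->. Qed.

Let addqA : associative addq.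
Proof. by move=> p q r; apply: quat_eq; rewrite /= addrA. Qed.
Let addqC : commutative addq.
Proof. by move=> p q; apply: quat_eq; rewrite /= addrC. Qed.
Let add0q : left_id (realq 0) addq.
Proof. by move=> p; apply: quat_eq; rewrite /= add0r. Qed.
Let addNq : left_inverse (realq 0) oppq addq.
Proof. by move=> p; apply: quat_eq; rewrite /= addNr. Qed.

HB.instance Definition _ :=
  GRing.isZmodule.Build (quat R) addqA addqC add0q addNq.

Let mulqA : associative mulq.
Proof. by move=> p q r; apply: quat_eq => /=; ring. Qed.
Let mul1q : left_id (realq 1) mulq.
Proof. by move=> p; apply: quat_eq => /=; ring. Qed.
Let mulq1 : right_id (realq 1) mulq.
Proof. by move=> p; apply: quat_eq => /=; ring. Qed.
Let mulqDl : left_distributive mulq addq.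
Proof. by move=> p q r; apply: quat_eq => /=; ring. Qed.
Let mulqDr : right_distributive mulq addq.
Proof. by move=> p q r; apply: quat_eq => /=; ring. Qed.
Let oneq_neq0 : realq 1 != realq 0.
Proof. by apply/eqP => -[] /eqP; rewrite oner_eq0. Qed.

HB.instance Definition _ := GRing.Zmodule_isNzRing.Build (quat R)
  mulqA mul1q mulq1 mulqDl mulqDr oneq_neq0.

Definition conjq q : quat R := Quat (qre q) (- qi q) (- qj q) (- qk q).

(* q * conjq q is a nonnegative real quaternion. *)
Definition normq q : R := Num.sqrt (qre (q * conjq q)).

End QuatRing.

(* A right module over quat R is a left module over the converse ring. *)
Definition rscale (R : realType) (V : lmodType (quat R)^c) (x : V)
  (a : quat R) : V := (a : (quat R)^c) *: x.

Notation "x *:> a" := (rscale x a) (at level 40, left associativity)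
  : ring_scope.

(* Used with f an inner product, for which f x x is real. *)
Definition norm_of (R : realType) (V : Type) (f : V -> V -> quat R) (x : V)
  : R := Num.sqrt (qre (f x x)).

(* The inner product is right linear in its second argument. By conjugate
   symmetry inner x x is a real quaternion, so positive definiteness is stated
   on its real part. *)
HB.mixin Record isRightQHilbert (R : realType) V
    of GRing.Lmodule (quat R)^c V := {
  inner : V -> V -> quat R;
  inner_conj : forall x y : V, inner y x = conjq (inner x y);
  inner_linear : forall (x y z : V) (a b : quat R),
    inner x (y *:> a + z *:> b) = inner x y * a + inner x z * b;
  inner_posdef : forall x : V, x != 0 -> 0 < qre (inner x x);
  hilbert_complete : forall u : nat -> V,
    (forall e : R, 0 < e -> exists N : nat, forall m n : nat,
       (N <= m)%N -> (N <= n)%N -> norm_of inner (u m - u n) < e) ->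
    exists l : V, norm_of inner (u n - l) @[n --> \oo] --> (0 : R)
}.

#[short(type="rightQHilbertType")]
HB.structure Definition RightQHilbert (R : realType) :=
  {V of isRightQHilbert R V & GRing.Lmodule (quat R)^c V}.

Section Operators.
Variables (R : realType) (H : rightQHilbertType R).
Implicit Types (T : H -> H) (x u v : H) (a b : quat R).

Definition hnorm x : R := norm_of inner x.

Definition right_linear T := forall u v a b,
  T (u *:> a + v *:> b) = T u *:> a + T v *:> b.

Definition real_linear T := forall u v (a b : R),
  T (u *:> realq a + v *:> realq b) = T u *:> realq a + T v *:> realq b.

Definition bounded_op T := exists2 K : R, 0 <= K &
  forall x, hnorm (T x) <= K * hnorm x.

Definition BH : set (H -> H) := [set T | right_linear T /\ bounded_op T].

Definition BR : set (H -> H) := [set T | real_linear T /\ bounded_op T].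

Definition invertible_in (A : set (H -> H)) T :=
  exists2 S, A S & cancel S T /\ cancel T S.

Definition T_lambda T (lambda : quat R) : H -> H :=
  fun x => x *:> lambda - T x.

Definition Delta T (lambda : quat R) : H -> H :=
  fun x => T (T x) - T x *:> realq (2 * qre lambda)
           + x *:> realq (normq lambda ^+ 2).

Definition right_spectrum T : set (quat R) :=
  [set lambda | ~ invertible_in BR (T_lambda T lambda)].

Definition S_spectrum T : set (quat R) :=
  [set lambda | ~ invertible_in BH (Delta T lambda)].

End Operators.

Arguments BH {R} H.
Arguments BR {R} H.

(* Main.v *)
Require Import Defs.
From mathcomp Require Import all_boot all_order all_algebra.
From mathcomp Require Import all_classical all_reals all_analysis.
From mathcomp Require Import ring lra.

(** Write [R_a] for the right multiplication [x |-> x a]. As [T] commutes with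
    every [R_a], and [l + l^*] and [l l^*] are real, [Delta_l] is the product
    of the commuting factors [T_l] and [T_(l^* )]. Hence if [Delta_l] has an
    inverse [S], then [S T_(l^* )] is an inverse of [T_l]. Conversely,
    [l^* = u^-1 l u] for any nonzero imaginary [u] orthogonal to [Im l], so
    [T_(l^* ) = R_u T_l R_(u^-1)] is invertible as soon as [T_l] is; then so is
    [Delta_l], and the inverse of a right linear map is right linear. *)

Set Implicit Arguments.
Unset Strict Implicit.
Unset Printing Implicit Defensive.

Import Order.TTheory GRing.Theory Num.Theory.
(* [normq] is also the name of a function of the [rat] library. *)
Import Defs.

Local Open Scope ring_scope.

(** * Quaternion conjugation, modulus and inverses *)

Section Quaternions.
Variable R : realType.
Implicit Types p q : quat R.

Lemma qreD p q : qre (p + q) = qre p + qre q.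
Proof. by []. Qed.

Lemma realqC (a : R) q : realq a * q = q * realq a.
Proof. by apply: quat_eq => /=; ring. Qed.

Lemma conjqK : involutive (@conjq R).
Proof. by move=> q; apply: quat_eq; rewrite /= ?opprK. Qed.

Lemma addq_conj q : q + conjq q = realq (2 * qre q).
Proof. by apply: quat_eq => /=; ring. Qed.

Lemma normq_sqr q :
  normq q ^+ 2 = qre q ^+ 2 + qi q ^+ 2 + qj q ^+ 2 + qk q ^+ 2.
Proof.
rewrite /normq /= sqr_sqrtr; first by ring.
have := (sqr_ge0 (qre q), sqr_ge0 (qi q), sqr_ge0 (qj q), sqr_ge0 (qk q)).
by case=> [[[]]] *; lra.
Qed.

Lemma mulq_conj q : q * conjq q = realq (normq q ^+ 2).
Proof. by rewrite normq_sqr; apply: quat_eq => /=; ring. Qed.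

Lemma mul_conjq q : conjq q * q = realq (normq q ^+ 2).
Proof. by rewrite normq_sqr; apply: quat_eq => /=; ring. Qed.

Lemma normq_sqr_eq0 q : (normq q ^+ 2 == 0) = (q == 0).
Proof.
apply/eqP/eqP => [|->]; last by rewrite normq_sqr /=; ring.
rewrite normq_sqr => q0.
have := (sqr_ge0 (qre q), sqr_ge0 (qi q), sqr_ge0 (qj q), sqr_ge0 (qk q)).
by case=> [[[]]] *; apply: quat_eq => /=; apply/eqP; rewrite -sqrf_eq0;
  apply/eqP; lra.
Qed.

Lemma quat_inverse q : q != 0 -> exists2 p, q * p = 1 & p * q = 1.
Proof.
rewrite -normq_sqr_eq0 => q0.
have realV : realq (normq q ^+ 2) * realq (normq q ^+ 2)^-1 = 1.
  by apply: quat_eq; rewrite /= ?mulr0 ?mul0r ?subr0 ?addr0 ?divff.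
exists (conjq q * realq (normq q ^+ 2)^-1); first by rewrite mulrA mulq_conj.
by rewrite -mulrA realqC mulrA mul_conjq.
Qed.

Lemma conjq_conjugate q : exists u v : quat R,
  [/\ u * v = 1, v * u = 1 & conjq q = v * q * u].
Proof.
have [u u0 qu] : exists2 u : quat R, u != 0 & u * conjq q = q * u.
  (* [u] is imaginary and orthogonal to the imaginary part of [q]. *)
  have [/andP[/eqP qi0 /eqP qj0]|] := boolP ((qi q == 0) && (qj q == 0)).
    (* The imaginary part of [q] is a multiple of [k], so [i] is orthogonal to it. *)
    exists (Quat 0 1 0 0); first by apply/eqP => -[] /eqP; rewrite oner_eq0.
    by apply: quat_eq => /=; rewrite ?qi0 ?qj0; ring.
  move=> q0; exists (Quat 0 (qj q) (- qi q) 0).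
    apply: contra q0 => /eqP -[-> /eqP]; rewrite oppr_eq0 => ->.
    by rewrite eqxx.
  by apply: quat_eq => /=; ring.
have [v uv vu] := quat_inverse u0.
by exists u, v; split=> //; rewrite -mulrA -qu mulrA vu mul1r.
Qed.

End Quaternions.

(** * Scalar multiplication from the right *)

Section RightScaling.
Variables (R : realType) (V : lmodType (quat R)^c).
Implicit Types (x y : V) (a b : quat R).

Lemma rscaleA x a b : x *:> a *:> b = x *:> (a * b).
Proof. exact: scalerA. Qed.

Lemma rscale1 x : x *:> (1 : quat R) = x.
Proof. exact: scale1r. Qed.

Lemma rscaleDl x a b : x *:> (a + b) = x *:> a + x *:> b.
Proof. exact: scalerDl. Qed.

Lemma rscaleDr x y a : (x + y) *:> a = x *:> a + y *:> a.
Proof. exact: scalerDr. Qed.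

Lemma rscaleN x a : (- x) *:> a = - (x *:> a).
Proof. exact: scalerN. Qed.

End RightScaling.

(** * The norm induced by the inner product *)

Section Norm.
Variables (R : realType) (H : rightQHilbertType R).
Implicit Types (x y : H) (a b : quat R).

Let innerDr x y z : inner x (y + z) = inner x y + inner x z.
Proof.
by rewrite -[y in LHS]rscale1 -[z in LHS]rscale1 inner_linear !mulr1.
Qed.

Let innerZr x y a : inner x (y *:> a) = inner x y * a.
Proof.
have := inner_linear x y y a 0.
by rewrite [y *:> 0]scale0r mulr0 !addr0.
Qed.

Let innerDl x y z : inner (x + y) z = inner x z + inner y z.
Proof.
rewrite inner_conj innerDr [inner x z]inner_conj [inner y z]inner_conj.
by apply: quat_eq => /=; ring.
Qed.

Let inner_ge0 x : 0 <= qre (inner x x).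
Proof.
have [->|/inner_posdef/ltW//] := eqVneq x 0.
by rewrite -(scale0r (0 : H)) innerZr mulr0.
Qed.

Lemma hnorm_ge0 x : 0 <= hnorm x.
Proof. exact: sqrtr_ge0. Qed.

Lemma hnorm_sqr x : hnorm x ^+ 2 = qre (inner x x).
Proof. by rewrite sqr_sqrtr. Qed.

Lemma hnormZ x a : hnorm (x *:> a) = normq a * hnorm x.
Proof.
have e : qre (inner (x *:> a) (x *:> a)) = normq a ^+ 2 * qre (inner x x).
  rewrite innerZr inner_conj innerZr normq_sqr.
  (* By conjugate symmetry each imaginary component of [inner x x] equals its own negative, so
     [inner x x] is real and commutes with [a]. *)
  have /(congr1 (@qi R)) := inner_conj x x.
  have /(congr1 (@qj R)) := inner_conj x x.
  have /(congr1 (@qk R)) := inner_conj x x.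
  move=> /= h1 h2 h3.
  have -> : inner x x = realq (qre (inner x x)).
    by apply: quat_eq => //=; lra.
  by rewrite /=; ring.
apply/eqP; rewrite -(eqrXn2 (n := 2)) ?hnorm_ge0 //.
  by rewrite exprMn !hnorm_sqr e.
by rewrite mulr_ge0 ?hnorm_ge0 ?sqrtr_ge0.
Qed.

Lemma hnormN x : hnorm (- x) = hnorm x.
Proof.
have -> : - x = x *:> (- 1) by rewrite /rscale scaleNr scale1r.
rewrite hnormZ; have -> : normq (-1 : quat R) = 1.
  by rewrite /normq /=; rewrite -[RHS]sqrtr1; congr Num.sqrt; ring.
by rewrite mul1r.
Qed.

(* The parallelogram law gives this weak triangle inequality directly,
   without Cauchy-Schwarz. *)
Lemma hnormD_weak x y : hnorm (x + y) <= 2 * (hnorm x + hnorm y).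
Proof.
have par : hnorm (x + y) ^+ 2 + hnorm (x - y) ^+ 2 =
    2 * hnorm x ^+ 2 + 2 * hnorm y ^+ 2.
  have ny2 := hnorm_sqr (- y); rewrite hnormN hnorm_sqr in ny2.
  have xy0 z : qre (inner z (- y)) = - qre (inner z y).
    have -> : - y = y *:> (- 1) by rewrite /rscale scaleNr scale1r.
    by rewrite innerZr mulrN1.
  have yx0 z : qre (inner (- y) z) = - qre (inner y z).
    by rewrite inner_conj /= xy0 [inner y z]inner_conj.
  rewrite !hnorm_sqr !innerDl !innerDr !qreD -ny2 xy0 yx0; ring.
have x0 := hnorm_ge0 x; have y0 := hnorm_ge0 y.
rewrite -(ler_pXn2r (n := 2)) ?nnegrE ?hnorm_ge0 //; last by lra.
(* Dropping the square of [hnorm (x - y)] from [par] bounds the left side by twice the sum of the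
   squared norms. *)
have := sqr_ge0 (hnorm (x - y)); have := mulr_ge0 x0 y0.
have := sqr_ge0 (hnorm x); have := sqr_ge0 (hnorm y); nra.
Qed.

End Norm.

(** * Bounded operators and their linearity *)

Section Operators.
Variables (R : realType) (H : rightQHilbertType R).
Implicit Types (S T : H -> H) (x y : H) (a b l : quat R).

Lemma bounded_comp S T :
  bounded_op S -> bounded_op T -> bounded_op (S \o T).
Proof.
move=> [K K0 hS] [L L0 hT]; exists (K * L); first exact: mulr_ge0.
by move=> x; rewrite -mulrA (le_trans (hS _)) ?ler_wpM2l.
Qed.

(** Any constant will do for boundedness, so the factor 2 of the weak triangle inequality is
    harmless. *)
Lemma bounded_sub S T :
  bounded_op S -> bounded_op T -> bounded_op (fun x => S x - T x).
Proof.
move=> [K K0 hS] [L L0 hT]; exists (2 * (K + L)); first by lra.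
move=> x; apply: le_trans (hnormD_weak _ _) _.
rewrite hnormN -mulrA mulrDl; have := (hS x, hT x); case; lra.
Qed.

Lemma bounded_rscale a : bounded_op (fun x : H => x *:> a).
Proof. by exists (normq a); [exact: sqrtr_ge0 | move=> x; rewrite hnormZ]. Qed.

Lemma BR_comp S T : BR H S -> BR H T -> BR H (S \o T).
Proof.
move=> [lS bS] [lT bT]; split; last exact: bounded_comp.
by move=> u v a b /=; rewrite lT lS.
Qed.

(** Real quaternions are central, so right multiplication is real linear, though in general not
    right linear. *)
Lemma BR_rscale c : BR H (fun x => x *:> c).
Proof.
split; last exact: bounded_rscale.
by move=> u v a b; rewrite rscaleDr !rscaleA !realqC.
Qed.

Lemma BH_sub_BR T : BH H T -> BR H T.
Proof. by move=> [lT bT]; split=> // u v a b; exact: lT. Qed.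

Lemma BR_T_lambda T l : BH H T -> BR H (T_lambda T l).
Proof.
move=> [lT bT]; split; last exact/bounded_sub/bT/bounded_rscale.
move=> u v a b; rewrite /T_lambda lT !rscaleDr !rscaleN !rscaleA !realqC.
by rewrite opprD addrACA.
Qed.

Lemma right_linearD T : right_linear T -> {morph T : x y / x + y}.
Proof. by move=> lT x y; have := lT x y 1 1; rewrite !rscale1. Qed.

Lemma right_linearZ T : right_linear T ->
  forall x a, T (x *:> a) = T x *:> a.
Proof.
by move=> lT x a; have := lT x x a 0; rewrite /rscale !scale0r !addr0.
Qed.

Lemma right_linearN T : right_linear T -> {morph T : x / - x}.
Proof.
move=> lT x; have := right_linearZ lT x (-1).
by rewrite /rscale !scaleNr !scale1r.
Qed.

Lemma right_linear_can S T : right_linear T -> cancel S T -> cancel T S ->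
  right_linear S.
Proof.
by move=> lT ST TS u v a b; apply: (can_inj TS); rewrite ST lT !ST.
Qed.

(** * Factorization of [Delta] and invertibility of the factors *)

Lemma right_linear_Delta T l : right_linear T -> right_linear (Delta T l).
Proof.
move=> lT u v a b; rewrite /Delta !lT !rscaleDr !rscaleN !rscaleA !realqC.
by rewrite [RHS]addrACA; congr (_ + _); rewrite opprD addrACA.
Qed.

(** The cross terms add up to [T x] times [l + conjq l], which is real. *)
Lemma T_lambda_conj_comp T l x : right_linear T ->
  T_lambda T l (T_lambda T (conjq l) x) = Delta T l x.
Proof.
move=> lT; rewrite /T_lambda /Delta (right_linearD lT) (right_linearN lT).
rewrite (right_linearZ lT) rscaleDr rscaleN !rscaleA mul_conjq -addq_conj.
rewrite rscaleDl !opprD !opprK.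
by rewrite [RHS]addrC -[LHS]addrA; congr (_ + _); rewrite [LHS]addrA addrC.
Qed.

(** Only the real part and the modulus of [l] enter; this yields the factorization in the opposite
    order. *)
Lemma Delta_conj T l x : Delta T (conjq l) x = Delta T l x.
Proof. by rewrite /Delta !normq_sqr /= !sqrrN. Qed.

Lemma T_lambda_conj_compC T l x : right_linear T ->
  T_lambda T (conjq l) (T_lambda T l x) = Delta T l x.
Proof.
by move=> lT; rewrite -Delta_conj -(T_lambda_conj_comp _ _ lT) conjqK.
Qed.

Lemma T_lambda_conjugate T l u v x : right_linear T -> v * u = 1 ->
  T_lambda T (v * l * u) x = T_lambda T l (x *:> v) *:> u.
Proof.
move=> lT vu; rewrite /T_lambda (right_linearZ lT) rscaleDr rscaleN !rscaleA.
by rewrite vu rscale1 mulrA.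
Qed.

Lemma invertible_T_lambda_conj T l : right_linear T ->
  invertible_in (BR H) (T_lambda T l) ->
  invertible_in (BR H) (T_lambda T (conjq l)).
Proof.
move=> lT [S bS [ST TS]]; have [u [v [uv vu ->]]] := conjq_conjugate l.
(* Scaling by [v] undoes the outer factor [u], and scaling by [u] undoes the inner factor [v]. *)
exists ((fun x => x *:> u) \o (S \o (fun x => x *:> v))).
  by apply: BR_comp (BR_rscale _) (BR_comp bS (BR_rscale _)).
split=> x.
  by rewrite T_lambda_conjugate //= rscaleA uv rscale1 ST rscaleA vu rscale1.
by rewrite T_lambda_conjugate //= rscaleA uv rscale1 TS rscaleA vu rscale1.
Qed.

Lemma invertible_T_lambdaE T l : BH H T ->
  invertible_in (BR H) (T_lambda T l) <-> invertible_in (BH H) (Delta T l).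
Proof.
move=> hT; have lT := hT.1; split=> [iT|[S bS [SD DS]]].
  have [S2 bS2 [ST2 TS2]] := invertible_T_lambda_conj lT iT.
  case: iT => S1 bS1 [ST1 TS1].
  have DS : cancel (Delta T l) (S2 \o S1).
    by move=> x; rewrite -T_lambda_conj_comp //= TS1 TS2.
  have SD : cancel (S2 \o S1) (Delta T l).
    by move=> x; rewrite -T_lambda_conj_comp //= ST2 ST1.
  (* The factors [S1] and [S2] are only known to be real linear; right linearity of the product is
     inherited from [Delta T l]. *)
  exists (S2 \o S1) => //; split; last exact: (BR_comp bS2 bS1).2.
  by have := right_linear_can (right_linear_Delta l lT) SD DS.
exists (S \o T_lambda T (conjq l)).
  exact: BR_comp (BH_sub_BR bS) (BR_T_lambda _ hT).
split=> x /=; last by rewrite T_lambda_conj_compC // DS.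
(* Both sides regroup one triple product. Moving [Delta T l] past [T_lambda T l] lets it cancel [S],
   which shows that the inverse is two-sided. *)
have DT y : Delta T l (T_lambda T l y) = T_lambda T l (Delta T l y).
  by rewrite -T_lambda_conj_comp // T_lambda_conj_compC.
by rewrite -[LHS]DS DT SD T_lambda_conj_comp // DS.
Qed.

End Operators.

Theorem theorem5 (R : realType) (H : rightQHilbertType R) (T : H -> H)
  (hT : BH H T) : right_spectrum T = S_spectrum T.
Proof.
by apply/seteqP; split=> l /= nT iT; apply: nT;
  [rewrite invertible_T_lambdaE | rewrite -invertible_T_lambdaE].
Qed.
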